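(* Let $P_X$ be a probability distribution on a context space $\mathcal{X}$, $\mathcal{A}$ a finite action set, $\pi_0$ a logging policy with $\pi_0(a|x)>0$ for all $(x,a)$, and $\pi_\theta$ a fixed policy with $w_m=\sup_{(x,a)\in\mathcal{X}\times\mathcal{A}}\pi_\theta(a|x)/\pi_0(a|x)<\infty$. Let $f_r:\mathcal{X}\times\mathcal{A}\to[-1,0]$ be a reward function. Let $S=(x_i,a_i,p_i,r_i)_{i=1}^n$ where $(x_i,a_i)$ are i.i.d. from $P_X\otimes\pi_0(A|X)$, $p_i=\pi_0(a_i|x_i)$ and $r_i=f_r(x_i,a_i)$, and let $\hat{R}(\pi_\theta,S)=\frac1n\sum_{i=1}^n r_i\frac{\pi_\theta(a_i|x_i)}{p_i}$. Then for every $\delta\in(0,1)$, with probability at least $1-\delta$ over the draw of $S$, $$R(\pi_\theta)\le \hat{R}(\pi_\theta,S)+\frac{w_m\log(1/\delta)}{3n}+\sqrt{\frac{\bigl(w_m\sqrt{2\min(D(\pi_\theta\|\pi_0),D_r(\pi_\theta\|\pi_0))}+2\bigr)\log(1/\delta)}{n}}.$$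
   Context: A policy is a conditional distribution $\pi(a|x)$ over $\mathcal{A}$ given $x$. The true risk is $R(\pi)=\mathbb{E}_{X\sim P_X}[\mathbb{E}_{A\sim\pi(\cdot|X)}[f_r(X,A)]]$. Conditional KL: $D(\pi_\theta\|\pi_0)=\int_{\mathcal{X}}\sum_a\pi_\theta(a|x)\log\frac{\pi_\theta(a|x)}{\pi_0(a|x)}\,dP_X(x)$; reverse conditional KL: $D_r(\pi_\theta\|\pi_0)=\int_{\mathcal{X}}\sum_a\pi_0(a|x)\log\frac{\pi_0(a|x)}{\pi_\theta(a|x)}\,dP_X(x)$ (possibly $+\infty$). *)

(* Defs.v *)
From HB Require Import structures.
From mathcomp Require Import all_boot all_order all_algebra.
From mathcomp Require Import all_classical all_reals all_analysis.
Set Implicit Arguments. Unset Strict Implicit. Unset Printing Implicit Defensive.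
Import Order.TTheory GRing.Theory Num.Theory.
Local Open Scope classical_set_scope.
Local Open Scope ring_scope.

Section defs.
Context {R : realType} {d : measure_display} {X : measurableType d} {A : finType}.

Definition is_policy (pi : X -> A -> R) : Prop :=
  [/\ (forall x a, 0 <= pi x a),
      (forall x, \sum_(a : A) pi x a = 1) &
      (forall a, measurable_fun setT (fun x => pi x a))].

Definition risk (PX : probability X R) (fr : X -> A -> R) (pi : X -> A -> R) : R :=
  Rintegral PX setT (fun x => \sum_(a : A) pi x a * fr x a).

Definition cond_KL (PX : probability X R) (pt p0 : X -> A -> R) : \bar R :=
  (\int[PX]_x (\sum_(a : A)
     (if pt x a == 0 then 0 else pt x a * ln (pt x a / p0 x a)))%:E)%E.

Definition rev_term (pt p0 : X -> A -> R) (x : X) (a : A) : \bar R :=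
  if p0 x a == 0 then 0%E
  else if pt x a == 0 then +oo%E
  else (p0 x a * ln (p0 x a / pt x a))%:E.

Definition rev_cond_KL (PX : probability X R) (pt p0 : X -> A -> R) : \bar R :=
  (\int[PX]_x (\sum_(a : A) rev_term pt p0 x a))%E.

Definition ratio_set (pt p0 : X -> A -> R) : set R :=
  [set r | exists x a, r = pt x a / p0 x a].

Definition emp_risk (n : nat) (fr : X -> A -> R) (pt p0 : X -> A -> R)
  (xs : 'I_n -> X) (acts : 'I_n -> A) : R :=
  n%:R^-1 * \sum_(i < n)
    (fr (xs i) (acts i) * (pt (xs i) (acts i) / p0 (xs i) (acts i))).

End defs.

Section sample.
Context {R : realType} {d : measure_display} {X : measurableType d} {A : finType}
  {dO : measure_display} {Omega : measurableType dO}.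

(* (x_i, a_i)_{i<n}, defined on the probability space (Omega, P), are
   i.i.d. with law P_X (x) pi0(A|X):
   - each x_i is measurable and each {a_i = c} is an event;
   - law: P[x_i in B, a_i in C] = int_B sum_{c in C} pi0(c|x) dP_X(x);
   - mutual independence: product rule on rectangle events
     {x_i in B_i, a_i in C_i} (a pi-system generating sigma(x_i,a_i)). *)
Definition iid_sample (P : probability Omega R) (PX : probability X R)
  (p0 : X -> A -> R) (n : nat) (xs : 'I_n -> Omega -> X) (acts : 'I_n -> Omega -> A) : Prop :=
  [/\ (forall i, measurable_fun setT (xs i)),
      (forall i (c : A), measurable (acts i @^-1` [set c])),
      (forall i (B : set X) (C : set A), measurable B ->
         P [set w | B (xs i w) /\ C (acts i w)] =
         (\int[PX]_(x in B) (\sum_(c : A | `[< C c >]) p0 x c)%:E)%E) &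
      (forall (B : 'I_n -> set X) (C : 'I_n -> set A), (forall i, measurable (B i)) ->
         P [set w | forall i, B i (xs i w) /\ C i (acts i w)] =
         (\prod_(i < n) P [set w | B i (xs i w) /\ C i (acts i w)])%E)].

End sample.

(* Main.v *)
(** The losses [Y_i = - f_r(x_i, a_i) pt(a_i|x_i) / p0(a_i|x_i)] are i.i.d.,
    take values in [[0, w_m]] and have mean [- R(pt)], so Bernstein's inequality,
    with the raw second moment in place of the variance, bounds the upper
    deviation of their average by
    [w_m L / (3 n) + sqrt (2 V L / n)], [L = log (1 / delta)], as soon as
    [E Y^2 <= V].  Since [|f_r| <= 1],
    [E Y^2 <= E sum_a pt^2 / p0 = 1 + E sum_a (pt - p0) pt / p0
            <= 1 + (w_m / 2) E sum_a |pt - p0|],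
    and Pinsker's inequality, in either direction, bounds the last expectation
    by [sqrt (2 min (D, D_r))].  Pinsker is used in the linearised form
    [sum_a |p - q| <= s + KL / (2 s)] for all [s > 0], which integrates over the
    contexts without Jensen's inequality and also covers [D_r = +oo]. *)
Require Import Defs.
From HB Require Import structures.
From mathcomp Require Import all_boot all_order all_algebra.
From mathcomp Require Import all_classical all_reals all_analysis.
From mathcomp Require Import measurable_realfun.
From mathcomp Require Import ring lra.
Import Order.TTheory GRing.Theory Num.Theory.
Import numFieldNormedType.Exports.
Local Open Scope classical_set_scope.
Local Open Scope ring_scope.

(** * Elementary inequalities *)

Section calculus.
Context {R : realType}.
Implicit Types (f df : R -> R) (x u p q s : R).

(** [0 < c * x] records only that [c] lies on the same side of 0 as [x]; this form treats both signs
    of [x] at once and suffices below. *)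
Lemma MVT_from0 {f df} x : (forall y : R, is_derive y (1 : R) f (df y)) -> x != 0 ->
  exists2 c, 0 < c * x & f x - f 0 = df c * x.
Proof.
move=> fdf x0.
have cf (A : set R) : {within A, continuous f}.
  apply: continuous_subspaceT => y; apply: differentiable_continuous.
  by apply/derivable1_diffP; have [] := fdf y.
case: (ltgtP x 0) x0 => // [x0|x0] _.
- have [c + e] := MVT x0 (fun y _ => fdf y) (cf _).
  rewrite in_itv/= => /andP[xc c0]; exists c; first by rewrite nmulr_rgt0.
  by rewrite -opprB e sub0r mulrN opprK.
- have [c + e] := MVT x0 (fun y _ => fdf y) (cf _).
  rewrite in_itv/= => /andP[xc c0]; exists c; first by rewrite pmulr_rgt0.
  by rewrite e subr0.
Qed.

Lemma derive_ge0_sign f df x : (forall y : R, is_derive y (1 : R) f (df y)) ->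
  f 0 = 0 -> (forall y, 0 <= df y) -> 0 <= x * f x.
Proof.
move=> fdf f0 df0; have [->|x0] := eqVneq x 0; first by rewrite mul0r.
have [c _] := MVT_from0 _ fdf x0; rewrite f0 subr0 => ->.
by rewrite mulrCA mulr_ge0// -expr2 sqr_ge0.
Qed.

(** With a derivative of the sign of [y], [f] falls before 0 and rises after it. Chained after
    [derive_ge0_sign], this yields inequalities on the whole line that are tight at 0. *)
Lemma derive_sign_ge0 f df x : (forall y : R, is_derive y (1 : R) f (df y)) ->
  f 0 = 0 -> (forall y, 0 <= y * df y) -> 0 <= f x.
Proof.
move=> fdf f0 df0; have [->|x0] := eqVneq x 0; first by rewrite f0.
have [c cx] := MVT_from0 _ fdf x0; rewrite f0 subr0 => ->.
by have := df0 c; nra.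
Qed.

(** The derivative [(x - 1) * expR x + 1] is nonnegative because [1 - x <= expR (- x)]. In both
    exponential inequalities below, the gap has this function as derivative, up to a positive
    factor. *)
Lemma sub2_mul_expR_sign u : 0 <= u * ((u - 2) * expR u + u + 2).
Proof.
apply: (@derive_ge0_sign (fun x => (x - 2) * expR x + x + 2)
  (fun x => (x - 1) * expR x + 1)) => [y||y].
- by apply: is_derive_eq; rewrite /GRing.scale/=; ring.
- by rewrite expR0; ring.
- have := expR_ge1Dx (- y); rewrite expRN => h.
  have e0 := expR_gt0 y.
  have : (1 - y) * expR y <= 1 by rewrite -ler_pdivlMr// div1r.
  by lra.
Qed.

(* The Bernstein bound [expR u <= 1 + u + u^2 / (2 (1 - u / 3))], cleared of
   denominators so that it holds for every [u]. *)
Lemma expR_bernstein u : (3 - u) * expR u <= 3 + 2 * u + u ^+ 2 / 2.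
Proof.
rewrite -subr_ge0.
apply: (@derive_sign_ge0 (fun x => 3 + 2 * x + x ^+ 2 / 2 - (3 - x) * expR x)
  (fun x => (x - 2) * expR x + x + 2)) => [y||y].
- by apply: is_derive_eq; rewrite /GRing.scale/=; field.
- by rewrite expR0; field.
- exact: sub2_mul_expR_sign.
Qed.

(** Freezing the denominator at the bound [b] leaves coefficients independent of [u], so that
    expectations can be taken. *)
Lemma expR_le_bernstein (b u : R) : 0 <= u <= b -> b < 3 ->
  expR u <= 1 + u + u ^+ 2 / (2 * (1 - b / 3)).
Proof.
move=> /andP[u0 ub] b3.
have u3 : 0 < 3 - u by lra.
have b3' : 0 < 2 * (1 - b / 3) by lra.
apply: (@le_trans _ _ (1 + u + u ^+ 2 / (2 * (1 - u / 3)))).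
  have -> : 1 + u + u ^+ 2 / (2 * (1 - u / 3)) =
            (3 + 2 * u + u ^+ 2 / 2) / (3 - u).
    by field; rewrite gt_eqF.
  by rewrite ler_pdivlMr// mulrC expR_bernstein.
rewrite lerD2l ler_wpM2l ?sqr_ge0// lef_pV2 ?posrE//; lra.
Qed.

(* The Pade-type bound
   [t ln t >= t - 1 + 3 (t - 1)^2 / (2 (t + 2))] with [t = expR u]. *)
Lemma expR_pade_ge0 u : let t := expR u in
  0 <= 2 * u * t ^+ 2 + 4 * u * t - 5 * t ^+ 2 + 4 * t + 1.
Proof.
apply: (@derive_sign_ge0 (fun u => 2 * u * expR u ^+ 2 + 4 * u * expR u
    - 5 * expR u ^+ 2 + 4 * expR u + 1)
  (fun x => 4 * expR x * ((x - 2) * expR x + x + 2))) => [y||y].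
- by apply: is_derive_eq; rewrite /GRing.scale/=; ring.
- by rewrite expR0; ring.
- by rewrite mulrCA mulr_ge0 ?sub2_mul_expR_sign.
Qed.

(** This is [expR_pade_ge0] at [t = p / q], made homogeneous by the factor [q ^+ 2]. *)
Lemma xlnx_pade p q : 0 < p -> 0 < q ->
  3 * (p - q) ^+ 2 <= (2 * p + 4 * q) * (p * ln (p / q) - p + q).
Proof.
move=> p0 q0; have t0 : 0 < p / q by rewrite divr_gt0.
have := expR_pade_ge0 (ln (p / q)); rewrite /= lnK ?posrE//.
set u := ln _; set t := p / q => h.
have -> : p = t * q by rewrite /t divfK ?gt_eqF.
rewrite -subr_ge0.
have -> : (2 * (t * q) + 4 * q) * (t * q * u - t * q + q) - 3 * (t * q - q) ^+ 2
  = q ^+ 2 * (2 * u * t ^+ 2 + 4 * u * t - 5 * t ^+ 2 + 4 * t + 1) by ring.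
by rewrite mulr_ge0// sqr_ge0.
Qed.

(** With [m = (p + 2 q) / 3] and [k = p ln (p / q) - p + q], the Pade bound reads
    [(p - q)^2 <= 2 m k], and AM-GM gives [|p - q| <= s m + k / (2 s)]. Summed over two probability
    vectors, [m] gives 1 and [k] gives [KL]. *)
Lemma norm_sub_le_xlnx p q s : 0 <= p -> 0 < q -> 0 < s ->
  `|p - q| <= s * (p + 2 * q) / 3 + (p * ln (p / q) - p + q) / (2 * s).
Proof.
move=> p0 q0 s0.
have s2 : 0 < 2 * s by lra.
set k := p * _ - _ + _; set m := (p + 2 * q) / 3.
have -> : s * (p + 2 * q) / 3 = s * m by rewrite mulrA.
have m0 : 0 < m by rewrite /m; lra.
have [k0 h] : 0 <= k /\ (p - q) ^+ 2 <= 2 * m * k.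
  move: p0; rewrite le_eqVlt => /orP[/eqP p0|p0].
    (* At [p = 0], which [xlnx_pade] excludes, [k = q] and [m = 2 q / 3], so the claim is
       [q^2 <= 4 q^2 / 3]. *)
    rewrite /k /m -p0 mul0r !add0r oppr0 add0r.
    by split; [lra|nra].
  have := xlnx_pade _ _ p0 q0; rewrite -/k => h.
  have e : 2 * p + 4 * q = 6 * m by rewrite /m; field.
  rewrite e in h; split; last by lra.
  have := le_trans (mulr_ge0 (ler0n _ 3) (sqr_ge0 (p - q))) h.
  by rewrite pmulr_rge0//; lra.
rewrite -[s * m](@mulfK _ (2 * s)) ?gt_eqF// -mulrDl ler_pdivlMr//.
rewrite -(@ler_pXn2r _ 2)// ?nnegrE; last 2 first.
- by rewrite mulr_ge0// ltW.
- by have := mulr_gt0 s0 m0; nra.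
rewrite exprMn real_normK ?num_real//.
(* This square is the gap in AM-GM, [(2 s^2 m + k)^2 - 8 s^2 m k]. *)
have : 0 <= (2 * s ^+ 2 * m - k) ^+ 2 by exact: sqr_ge0.
have : s ^+ 2 * (p - q) ^+ 2 <= s ^+ 2 * (2 * m * k).
  by rewrite ler_wpM2l// sqr_ge0.
lra.
Qed.

End calculus.

(** * Divergences between probability vectors on a finite set *)

Section finite_divergence.
Context {R : realType} {A : finType}.
Implicit Types (p q : A -> R) (s w : R).

(** A term with [p a = 0] vanishes through its factor [p a], so the usual convention needs no case
    split; the value is the true divergence when [q] is positive. *)
Definition KL p q : R := \sum_a p a * ln (p a / q a).

(** Adding [q a - p a], which sums to 0, makes every term nonnegative. *)
Lemma KL_ge0 p q : (forall a, 0 <= p a) -> (forall a, 0 < q a) ->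
  \sum_a p a = 1 -> \sum_a q a = 1 -> 0 <= KL p q.
Proof.
move=> p0 q0 p1 q1.
have -> : KL p q = \sum_a (p a * ln (p a / q a) - p a + q a).
  by rewrite !big_split/= sumrN p1 q1 addrNK.
apply: sumr_ge0 => a _; have [pa0|pa0] := eqVneq (p a) 0.
  by rewrite pa0 mul0r oppr0 !add0r ltW.
have {pa0}pa : 0 < p a by rewrite lt_def pa0 p0.
have := le_trans (mulr_ge0 (ler0n R 3) (sqr_ge0 (p a - q a)))
  (xlnx_pade _ _ pa (q0 a)).
by rewrite pmulr_rge0//; have := q0 a; lra.
Qed.

(* Pinsker's inequality, linearised: optimising over [s] gives
   [sum |p - q| <= sqrt (2 KL)]. *)
Lemma pinsker_linear p q s : (forall a, 0 <= p a) -> (forall a, 0 < q a) ->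
  \sum_a p a = 1 -> \sum_a q a = 1 -> 0 < s ->
  \sum_a `|p a - q a| <= s + KL p q / (2 * s).
Proof.
move=> p0 q0 p1 q1 s0.
apply: (le_trans (ler_sum _ (fun a _ => norm_sub_le_xlnx _ _ _ (p0 a) (q0 a) s0))).
rewrite big_split/= -!mulr_suml -mulr_sumr big_split/= -mulr_sumr p1 q1.
rewrite !big_split/= sumrN p1 q1 -/(KL p q) addrNK lerD2r.
by rewrite -mulrA -[leRHS]mulr1 ler_wpM2l//; lra.
Qed.

(** Write [p^2 / q = p + (p - q) (p / q)] and bound the last product by [w] times the positive part
    of [p - q], which is [(|p - q| + (p - q)) / 2]. The differences sum to 0, whence the factor
    [w / 2]. *)
Lemma sum_sqr_div_le p q w : (forall a, 0 <= p a) -> (forall a, 0 < q a) ->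
  \sum_a p a = 1 -> \sum_a q a = 1 -> (forall a, p a / q a <= w) ->
  \sum_a p a ^+ 2 / q a <= 1 + w / 2 * \sum_a `|p a - q a|.
Proof.
move=> p0 q0 p1 q1 pqw.
have -> : 1 + w / 2 * (\sum_a `|p a - q a|) =
    \sum_a (p a + w / 2 * (`|p a - q a| + (p a - q a))).
  rewrite big_split/= p1 -mulr_sumr !big_split/= sumrN p1 q1.
  by rewrite subrr addr0.
apply: ler_sum => a _.
have t0 : 0 <= p a / q a by rewrite divr_ge0// ltW.
have := pqw a.
have -> : p a ^+ 2 / q a = p a + (p a - q a) * (p a / q a).
  by field; rewrite gt_eqF.
move: t0; move: (p a / q a) (p a - q a) => t z t0 tw; rewrite lerD2l.
by case: (ger0P z) => z0; nra.
Qed.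

Lemma sum_sqr_div_le_KL p q w s : (forall a, 0 <= p a) -> (forall a, 0 < q a) ->
  \sum_a p a = 1 -> \sum_a q a = 1 -> (forall a, p a / q a <= w) ->
  0 <= w -> 0 < s ->
  \sum_a p a ^+ 2 / q a <= 1 + w / 2 * s + w / (4 * s) * KL p q.
Proof.
move=> p0 q0 p1 q1 pqw w0 s0.
rewrite (le_trans (sum_sqr_div_le _ _ _ p0 q0 p1 q1 pqw))// -addrA lerD2l.
have -> : w / (4 * s) * KL p q = w / 2 * (KL p q / (2 * s)).
  by field; rewrite gt_eqF.
rewrite -mulrDr ler_wpM2l//; first by rewrite divr_ge0.
exact: pinsker_linear.
Qed.

(** The distance [|p - q|] is symmetric, so Pinsker's inequality may be applied to the pair [q],
    [p]. *)
Lemma sum_sqr_div_le_revKL p q w s : (forall a, 0 < p a) -> (forall a, 0 < q a) ->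
  \sum_a p a = 1 -> \sum_a q a = 1 -> (forall a, p a / q a <= w) ->
  0 <= w -> 0 < s ->
  \sum_a p a ^+ 2 / q a <= 1 + w / 2 * s + w / (4 * s) * KL q p.
Proof.
move=> p0 q0 p1 q1 pqw w0 s0.
have p0' a := ltW (p0 a); have q0' a := ltW (q0 a).
rewrite (le_trans (sum_sqr_div_le _ _ _ p0' q0 p1 q1 pqw))// -addrA lerD2l.
have -> : w / (4 * s) * KL q p = w / 2 * (KL q p / (2 * s)).
  by field; rewrite gt_eqF.
rewrite -mulrDr ler_wpM2l//; first by rewrite divr_ge0.
under eq_bigr do rewrite distrC.
exact: pinsker_linear.
Qed.

End finite_divergence.

(** * Expectations of products over the sample *)

Section change_of_variables.
Context {R : realType} {d : measure_display} {X : measurableType d}.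
Import HBNNSimple.

(** Monotone convergence along simple functions: the right-hand side involves [mu], [phi] and [H]
    only through integrals of [H] against indicators of [phi]. *)
Lemma integral_weight_approx {dT : measure_display} {T : measurableType dT}
  (mu : measure T R) (phi : T -> X) (H : T -> R) (f : X -> R)
  (mf : measurable_fun setT (EFin \o f)) :
  measurable_fun setT phi -> measurable_fun setT H ->
  (forall t, 0 <= H t) -> (forall x, 0 <= f x) ->
  (\int[mu]_t (H t * f (phi t))%:E = limn (fun n =>
    \sum_(y \in range (nnsfun_approx measurableT mf n))
      (y%:E * \int[mu]_t (H t *
         \1_(nnsfun_approx measurableT mf n @^-1` [set y]) (phi t))%:E)))%E.
Proof.
move=> mphi mH H0 f0; set g := nnsfun_approx measurableT mf.
have mg n : measurable_fun setT (fun t => g n (phi t)).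
  exact: measurableT_comp.
transitivity (limn (fun n => \int[mu]_t (H t * g n (phi t))%:E)%E).
  rewrite -monotone_convergence//; last 3 first.
  - by move=> n; apply/measurable_EFinP; apply: measurable_funM.
  - by move=> n t _; rewrite lee_fin mulr_ge0.
  - move=> t _ m n mn; rewrite lee_fin ler_wpM2l//.
    by have /lefP := nd_nnsfun_approx measurableT mf mn; exact.
  apply: eq_integral => t _; apply/esym/cvg_lim => //=.
  under eq_fun do rewrite EFinM.
  rewrite EFinM; apply: cvgeZl => //.
  by apply: (@cvg_nnsfun_approx _ _ _ _ measurableT _ mf) => // x _; rewrite lee_fin.
congr (limn _); apply/funext => n.
have mi y : measurable_fun setT
    (fun t => (H t * \1_(g n @^-1` [set y]) (phi t))%:E).
  apply/measurable_EFinP; apply: measurable_funM => //.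
  by apply: measurableT_comp => //; exact: measurable_indic.
transitivity (\int[mu]_t (\sum_(y \in range (g n))
    (y%:E * (H t * \1_(g n @^-1` [set y]) (phi t))%:E)))%E.
  apply: eq_integral => t _; rewrite (fimfunE (g n)).
  rewrite !fsbig_finite//= mulr_sumr -sumEFin.
  by apply: eq_bigr => y _; rewrite -EFinM mulrCA.
(* Here [y] may be negative, but its level set is then empty and the product is 0. *)
have y0 y t : (0 <= y%:E * (H t * \1_(g n @^-1` [set y]) (phi t))%:E)%E.
  rewrite indicE; case: (boolP (_ \in _)) => [|_]; last by rewrite mulr0 mule0.
  by rewrite inE /= => <-; rewrite mulr1 -EFinM lee_fin mulr_ge0.
rewrite ge0_integral_fsum//; last first.
  by move=> y; apply: emeasurable_funM => //.
apply: eq_fsbigr => y; rewrite inE => -[x _ <-].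
rewrite ge0_integralZl_EFin// => t _.
by rewrite lee_fin mulr_ge0// indicE.
Qed.

(** Agreement on indicators extends to nonnegative measurable functions. The weights will carry
    either a density or the contribution of the other sample points. *)
Lemma integral_weight_eq {d1 d2 : measure_display}
  {T1 : measurableType d1} {T2 : measurableType d2}
  (mu1 : measure T1 R) (mu2 : measure T2 R)
  (phi1 : T1 -> X) (phi2 : T2 -> X) (H1 : T1 -> R) (H2 : T2 -> R) (f : X -> R) :
  measurable_fun setT phi1 -> measurable_fun setT phi2 ->
  measurable_fun setT H1 -> measurable_fun setT H2 ->
  (forall t, 0 <= H1 t) -> (forall t, 0 <= H2 t) ->
  (forall B : set X, measurable B ->
    \int[mu1]_t (H1 t * \1_B (phi1 t))%:E =
    \int[mu2]_t (H2 t * \1_B (phi2 t))%:E)%E ->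
  measurable_fun setT f -> (forall x, 0 <= f x) ->
  (\int[mu1]_t (H1 t * f (phi1 t))%:E = \int[mu2]_t (H2 t * f (phi2 t))%:E)%E.
Proof.
move=> mphi1 mphi2 mH1 mH2 H10 H20 eqB mf f0.
have mEf : measurable_fun setT (EFin \o f) by exact/measurable_EFinP.
rewrite (integral_weight_approx mu1 phi1 H1 f mEf)//.
rewrite (integral_weight_approx mu2 phi2 H2 f mEf)//.
by congr (limn _); apply/funext => n; apply: eq_fsbigr => y _; rewrite eqB.
Qed.

End change_of_variables.

(** * Law and independence of the sample, from events to functions *)

Section sample.
Context {R : realType} {d dO : measure_display} {X : measurableType d}
  {A : finType} {Omega : measurableType dO}.

Lemma measurable_fun_act {a : Omega -> A} (c : A) :
  measurable (a @^-1` [set c]) ->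
  measurable_fun setT (fun w => (a w == c)%:R : R).
Proof.
move=> mc.
have -> : (fun w => (a w == c)%:R : R) = \1_(a @^-1` [set c]).
  apply/funext => w; rewrite indicE; congr ((nat_of_bool _)%:R).
  by apply/eqP/idP; rewrite inE.
exact: measurable_indic.
Qed.

(** Expanding over the finitely many actions reduces functions of a context and an action to
    functions of the context alone. *)
Lemma sum_act (g : A -> R) a : \sum_c (a == c)%:R * g c = g a.
Proof.
rewrite (bigD1 a)//= eqxx mul1r big1 ?addr0// => c ca.
by rewrite eq_sym (negbTE ca) mul0r.
Qed.

Lemma measurable_fun_xact (x : Omega -> X) (a : Omega -> A) (g : X -> A -> R) :
  measurable_fun setT x -> (forall c, measurable (a @^-1` [set c])) ->
  (forall c, measurable_fun setT (g ^~ c)) ->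
  measurable_fun setT (fun w => g (x w) (a w)).
Proof.
move=> mx ma mg; under eq_fun do rewrite -sum_act.
apply: measurable_sum => c; apply: measurable_funM.
  exact: measurable_fun_act.
exact: (measurableT_comp (mg c)).
Qed.

Lemma ge0_integral_act (mu : measure Omega R) (x : Omega -> X) (a : Omega -> A)
  (H : Omega -> R) (g : X -> A -> R) :
  measurable_fun setT x -> (forall c, measurable (a @^-1` [set c])) ->
  (forall c, measurable_fun setT (g ^~ c)) -> measurable_fun setT H ->
  (forall w, 0 <= H w) -> (forall x a, 0 <= g x a) ->
  (\int[mu]_w (H w * g (x w) (a w))%:E =
   \sum_c \int[mu]_w (H w * (a w == c)%:R * g (x w) c)%:E)%E.
Proof.
move=> mx ma mg mH H0 g0; rewrite -ge0_integral_sum//.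
- apply: eq_integral => w _; rewrite sumEFin -[in LHS]sum_act mulr_sumr.
  by under eq_bigr do rewrite mulrA.
- move=> c; apply/measurable_EFinP; apply: measurable_funM.
    by apply: measurable_funM => //; exact: measurable_fun_act.
  exact: (measurableT_comp (mg c)).
- by move=> c w _; rewrite lee_fin !mulr_ge0.
Qed.

Context (P : probability Omega R) (PX : probability X R) (p0 : X -> A -> R)
  (n : nat) (xs : 'I_n -> Omega -> X) (acts : 'I_n -> Omega -> A).

Lemma integral_sample_indic i (B : set X) c : iid_sample P PX p0 xs acts ->
  measurable B ->
  (\int[P]_w ((acts i w == c)%:R * \1_B (xs i w))%:E =
   P [set w | B (xs i w) /\ [set c] (acts i w)])%E.
Proof.
move=> [mx ma _ _] mB.
have e : [set w | B (xs i w) /\ [set c] (acts i w)] =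
    (xs i @^-1` B) `&` (acts i @^-1` [set c]) by [].
rewrite -[X in P X]setIT -integral_indic//; last first.
  by rewrite e; apply: measurableI => //; rewrite -[X in measurable X]setTI; exact: mx.
apply: eq_integral => w _; rewrite e indicI/= !indicE mulrC; congr (_ * _%:R)%:E.
by congr nat_of_bool; apply/eqP/idP; rewrite inE.
Qed.

(** On the slice [acts i = c], the context [xs i] has density [p0 ^~ c] with respect to [PX]; the
    expectation is the sum over these slices. *)
Lemma integral_sample_law i (g : X -> A -> R) : iid_sample P PX p0 xs acts ->
  is_policy p0 ->
  (forall c, measurable_fun setT (g ^~ c)) -> (forall x a, 0 <= g x a) ->
  (\int[P]_w (g (xs i w) (acts i w))%:E =
   \int[PX]_x (\sum_c p0 x c * g x c)%:E)%E.
Proof.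
move=> iid [p0_ge0 _ mp0] mg g0; have [mx ma law _] := iid.
transitivity (\int[P]_w (1 * g (xs i w) (acts i w))%:E)%E.
  by apply: eq_integral => w _; rewrite mul1r.
rewrite (@ge0_integral_act P (xs i) (acts i) (cst 1))//.
under [RHS]eq_integral do rewrite -sumEFin.
rewrite ge0_integral_sum//; last 2 first.
- by move=> c; apply/measurable_EFinP; apply: measurable_funM.
- by move=> c x _; rewrite lee_fin mulr_ge0.
apply: eq_bigr => c _.
under eq_integral do rewrite mul1r.
apply: (integral_weight_eq P PX (xs i) id _ (p0 ^~ c) (g ^~ c)) => //.
- exact: measurable_fun_act.
move=> B mB; rewrite integral_sample_indic// law// [LHS]integral_mkcond.
apply: eq_integral => x _; rewrite patchE indicE; case: ifPn => _.
  rewrite mulr1 (big_pred1 c)// => a /=.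
  by apply/asboolP/eqP.
by rewrite mulr0.
Qed.

(** Independence on rectangles extends to nonnegative functions. Finiteness of each factor lets the
    expectations of the other coordinates act as a real constant under the integral. *)
Lemma integral_sample_prod (g : 'I_n -> X -> A -> R) :
  iid_sample P PX p0 xs acts ->
  (forall i c, measurable_fun setT (g i ^~ c)) ->
  (forall i x a, 0 <= g i x a) ->
  (forall i, \int[P]_w (g i (xs i w) (acts i w))%:E < +oo)%E ->
  (\int[P]_w (\prod_i g i (xs i w) (acts i w))%:E =
   \prod_i \int[P]_w (g i (xs i w) (acts i w))%:E)%E.
Proof.
move=> iid; have [mx ma _ indep] := iid.
(* Replace the indicators of rectangles by arbitrary functions, one
   coordinate at a time. *)
suff main k : forall g : 'I_n -> X -> A -> R,
    (forall i : 'I_n, (k <= i)%N -> exists (B : set X) c,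
       measurable B /\ g i = (fun x a => (a == c)%:R * \1_B x)) ->
    (forall i c, measurable_fun setT (g i ^~ c)) ->
    (forall i x a, 0 <= g i x a) ->
    (forall i, \int[P]_w (g i (xs i w) (acts i w))%:E < +oo)%E ->
    (\int[P]_w (\prod_i g i (xs i w) (acts i w))%:E =
     \prod_i \int[P]_w (g i (xs i w) (acts i w))%:E)%E.
  by apply: (main n) => i; rewrite leqNgt ltn_ord.
elim: k => {g} [|k IH] g gind mg g0 goo.
  (* At [k = 0] every factor is the indicator of a rectangle, and the claim is the product rule of
     [iid_sample]. *)
  have /choice[Bc gE] : forall i, exists Bc : set X * A,
      measurable Bc.1 /\ g i = (fun x a => (a == Bc.2)%:R * \1_(Bc.1) x).
    by move=> i; have [B [c ?]] := gind i isT; exists (B, c).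
  have mB i := (gE i).1.
  under [RHS]eq_bigr => i _.
    under eq_integral do rewrite (gE i).2.
    rewrite integral_sample_indic//; over.
  rewrite -(indep (fun i => (Bc i).1) (fun i => [set (Bc i).2]))//.
  set E := [set w | _].
  have EE : E = \bigcap_(i in [set: 'I_n])
      ((xs i @^-1` (Bc i).1) `&` (acts i @^-1` [set (Bc i).2])).
    by apply/seteqP; split => [w h i _|w h i]; [exact: h|exact: (h i Logic.I)].
  rewrite -[X in P X]setIT -integral_indic//; last first.
    rewrite EE; apply: fin_bigcap_measurable => // i _.
    by apply: measurableI => //; rewrite -[X in measurable X]setTI; exact: mx.
  apply: eq_integral => w _; congr EFin; rewrite indicE.
  have [wE|wE] := pselect (E w).
    rewrite mem_set// big1// => i _; rewrite (gE i).2.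
    by have [h1 /= ->] := wE i; rewrite eqxx mul1r indicE mem_set.
  rewrite memNset//; apply/eqP; rewrite prodf_seq_eq0; apply/hasP.
  have [i hi] : exists i, ~ ((Bc i).1 (xs i w) /\ [set (Bc i).2] (acts i w)).
    by apply/existsNP => h; apply: wE.
  exists i; rewrite ?mem_index_enum//= (gE i).2 indicE.
  have [ac|_] := eqVneq (acts i w) (Bc i).2; last by rewrite mul0r.
  by rewrite memNset ?mulr0// => hB; apply: hi.
have [kn|nk] := ltnP k n; last first.
  by apply: IH => // i ki; have := leq_ltn_trans (leq_trans nk ki) (ltn_ord i); rewrite ltnn.
(* Coordinate [k] is the one freed from being an indicator. With the other factors frozen,
   [integral_weight_eq] compares the weights [rest] and [fine K]. *)
pose i0 := Ordinal kn.
pose rest w := \prod_(j | j != i0) g j (xs j w) (acts j w).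
pose K := (\prod_(j | j != i0) \int[P]_w (g j (xs j w) (acts j w))%:E)%E.
have intg0 j : (0 <= \int[P]_w (g j (xs j w) (acts j w))%:E)%E.
  by apply: integral_ge0 => w _; rewrite lee_fin.
have K0 : (0 <= K)%E by apply: prode_ge0.
have Kfin : K \is a fin_num.
  apply: prode_fin_num => j _; rewrite ge0_fin_numE//.
have mrest : measurable_fun setT rest.
  rewrite /rest; under eq_fun do rewrite -big_filter.
  by apply: measurable_prod => j _; exact: measurable_fun_xact.
have rest0 w : 0 <= rest w by apply: prodr_ge0.
transitivity (\int[P]_w (rest w * g i0 (xs i0 w) (acts i0 w))%:E)%E.
  by apply: eq_integral => w _; rewrite (bigD1 i0)//= mulrC.
transitivity (\int[P]_w (fine K * g i0 (xs i0 w) (acts i0 w))%:E)%E; last first.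
  under eq_integral do rewrite EFinM.
  rewrite ge0_integralZl_EFin//; last 3 first.
  - by move=> w _; rewrite lee_fin.
  - by apply/measurable_EFinP; exact: measurable_fun_xact.
  - by rewrite fine_ge0.
  by rewrite fineK// [RHS](bigD1 i0)//= muleC.
rewrite (@ge0_integral_act P (xs i0) (acts i0) rest)//.
rewrite (@ge0_integral_act P (xs i0) (acts i0) (cst (fine K)))//; last first.
  by move=> w; rewrite /= fine_ge0.
apply: eq_bigr => c _.
apply: (integral_weight_eq P P (xs i0) (xs i0) _ (fun w => fine K * (acts i0 w == c)%:R) (g i0 ^~ c)) => //.
- by apply: measurable_funM => //; exact: measurable_fun_act.
- by apply: measurable_funM => //; exact: measurable_fun_act.
- by move=> w; rewrite mulr_ge0.
- by move=> w; rewrite mulr_ge0// fine_ge0.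
move=> B mB.
(* Putting the indicator [h] back at coordinate [k] gives a family to which the induction hypothesis
   applies. *)
pose h (x : X) (a : A) : R := (a == c)%:R * \1_B x.
pose g' j := if j == i0 then h else g j.
have h0 x a : 0 <= h x a by rewrite mulr_ge0.
have mh a : measurable_fun setT (h ^~ a).
  by apply: measurable_funM => //; exact: measurable_indic.
have g'E j : j != i0 -> g' j = g j by rewrite /g' => /negbTE ->.
have g'0E : g' i0 = h by rewrite /g' eqxx.
transitivity (\int[P]_w (\prod_i g' i (xs i w) (acts i w))%:E)%E.
  apply: eq_integral => w _; rewrite (bigD1 i0)//= g'0E -mulrA mulrC.
  by congr (_ * _)%:E; apply: eq_bigr => j /g'E ->.
rewrite IH; first last.
- move=> i; have [->|/g'E -> //] := eqVneq i i0.
  rewrite g'0E /h integral_sample_indic//.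
  apply: le_lt_trans (probability_le1 P _) (ltry _).
  rewrite (_ : [set w | _] = (xs i0 @^-1` B) `&` (acts i0 @^-1` [set c]))//.
  by apply: measurableI => //; rewrite -[X in measurable X]setTI; exact: mx.
- by move=> i x a; have [->|/g'E -> //] := eqVneq i i0; rewrite g'0E.
- by move=> i a; have [->|/g'E -> //] := eqVneq i i0; rewrite g'0E.
- move=> i; rewrite leq_eqVlt => /orP[/eqP ki|ki].
    exists B, c; split => //.
    by have -> : i = i0 by exact/val_inj.
  by rewrite g'E; [exact: gind|rewrite -val_eqE/= gt_eqF].
rewrite (bigD1 i0)//= g'0E.
under [X in (_ * X)%E]eq_bigr => j /g'E -> do [].
rewrite -/K -(fineK Kfin) muleC -ge0_integralZl_EFin//; last 3 first.
- by move=> w _; rewrite lee_fin.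
- by apply/measurable_EFinP; exact: measurable_fun_xact.
- by rewrite fine_ge0.
by apply: eq_integral => w _; rewrite -EFinM /h mulrA.
Qed.

End sample.

(** * Second moment of the importance weights and deviation bound *)

Section risk_bound.
Context {R : realType} {d : measure_display} {X : measurableType d}.

Lemma measurable_fun_invr (f : X -> R) : measurable_fun setT f ->
  (forall x, 0 < f x) -> measurable_fun setT (fun x => (f x)^-1).
Proof.
move=> mf f0.
have -> : (fun x => (f x)^-1) = (fun x => expR (- ln (f x))).
  by apply/funext => x; rewrite expRN lnK// posrE.
apply: (measurableT_comp (@measurable_expR R)).
apply: measurableT_comp => //.
exact: (measurableT_comp (@measurable_ln R)).
Qed.

(** The function [g] is extended-valued so as to cover the reverse divergence, whose integrand may
    be infinite. *)
Lemma integral_le_affine (mu : probability X R) (f : X -> R) (g : X -> \bar R)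
    (a b : R) :
  measurable_fun setT f -> (forall x, 0 <= f x) ->
  measurable_fun setT g -> (forall x, 0 <= g x)%E -> 0 <= a -> 0 <= b ->
  (forall x, (f x)%:E <= a%:E + b%:E * g x)%E ->
  (\int[mu]_x (f x)%:E <= a%:E + b%:E * \int[mu]_x g x)%E.
Proof.
move=> mf f0 mg g0 a0 b0 fg.
have mbg : measurable_fun setT (fun x => b%:E * g x)%E.
  exact: emeasurable_funM.
have bg0 x : (0 <= b%:E * g x)%E by rewrite mule_ge0// lee_fin.
apply: (@le_trans _ _ (\int[mu]_x (a%:E + b%:E * g x))%E).
  apply: ge0_le_integral => //.
  - by move=> x _; rewrite lee_fin.
  - exact/measurable_EFinP.
  - exact: emeasurable_funD.
rewrite ge0_integralD//.
rewrite integral_cst// ge0_integralZl_EFin//.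
by rewrite [X in (_ * X)%E]probability_setT mule1.
Qed.

Lemma integral_affine (mu : probability X R) (f g : X -> R) (a b c : R) :
  measurable_fun setT f -> measurable_fun setT g ->
  (forall x, 0 <= f x) -> (forall x, 0 <= g x) ->
  0 <= a -> 0 <= b -> 0 <= c ->
  (\int[mu]_x (a + b * f x + c * g x)%:E =
   a%:E + b%:E * \int[mu]_x (f x)%:E + c%:E * \int[mu]_x (g x)%:E)%E.
Proof.
move=> mf mg f0 g0 a0 b0 c0.
have mb : measurable_fun setT (fun x => (b * f x)%:E).
  by apply/measurable_EFinP; exact: measurable_funM.
have mc : measurable_fun setT (fun x => (c * g x)%:E).
  by apply/measurable_EFinP; exact: measurable_funM.
under eq_integral do rewrite !EFinD.
rewrite ge0_integralD//; first last.
- by move=> x _; rewrite lee_fin mulr_ge0.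
- exact: emeasurable_funD.
- by move=> x _; rewrite -EFinD lee_fin addr_ge0// mulr_ge0.
rewrite ge0_integralD//; first last.
- by move=> x _; rewrite lee_fin mulr_ge0.
under [X in (_ + X + _)%E]eq_integral do rewrite EFinM.
under [X in (_ + X)%E]eq_integral do rewrite EFinM.
rewrite integral_cst// !ge0_integralZl_EFin//; first last.
- exact/measurable_EFinP.
- by move=> x _; rewrite lee_fin.
- exact/measurable_EFinP.
- by move=> x _; rewrite lee_fin.
by rewrite [X in (_ * X + _ + _)%E]probability_setT mule1.
Qed.

(** Markov's inequality for [expR (l * S)]; the event is strict, as the complement of a non-strict
    bound. *)
Lemma chernoff_gt (mu : probability X R) (S : X -> R) (l t : R) :
  measurable_fun setT S -> 0 <= l ->
  (mu [set x | (t < S x)%R] * (expR (l * t))%:E <= \int[mu]_x (expR (l * S x))%:E)%E.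
Proof.
move=> mS l0.
have mE : measurable [set x | t < S x].
  have -> : [set x | t < S x] = S @^-1` `]t, +oo[%classic.
    by apply/seteqP; split => x /=; rewrite in_itv/= andbT.
  by rewrite -[X in measurable X]setTI; exact: mS.
rewrite muleC -(setIT [set x | _]) -integral_indic//.
rewrite -ge0_integralZl_EFin ?expR_ge0//; last first.
  by apply/measurable_EFinP; exact: measurable_indic.
apply: ge0_le_integral => //.
- apply: emeasurable_funM => //.
  by apply/measurable_EFinP; exact: measurable_indic.
- apply/measurable_EFinP; apply: (measurableT_comp (@measurable_expR R)).
  exact: measurable_funM.
move=> x _; rewrite -EFinM lee_fin indicE.
case: (boolP (x \in _)) => [|_]; last by rewrite mulr0 expR_ge0.
by rewrite inE/= mulr1 => tS; rewrite ler_expR ler_wpM2l// ltW.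
Qed.

(** The minimum is at [s = sqrt (2 m) / 2]. For [m = 0] it is not attained, and [s] is sent to 0
    instead. *)
Lemma le_sqrt_of_linear (c w m : R) : 0 <= w -> 0 <= m ->
  (forall s, 0 < s -> c <= 1 + w / 2 * s + w / (4 * s) * m) ->
  c <= 1 + w / 2 * Num.sqrt (2 * m).
Proof.
move=> w0; rewrite le_eqVlt => /orP[/eqP <-|m0] h.
  rewrite mulr0 sqrtr0 mulr0; apply/ler_addgt0Pr => e e0.
  have w1 : 0 < w + 1 by lra.
  (* Dividing by [w + 1] rather than [w] allows [w = 0]. *)
  have := h (e / (w + 1)) (divr_gt0 e0 w1); rewrite mulr0 !addr0 => hc.
  apply: (le_trans hc); rewrite lerD2l mulrCA.
  rewrite -[leRHS]mulr1 ler_wpM2l// ?(ltW e0)//.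
  by rewrite ler_pdivrMr//; lra.
set q := Num.sqrt (2 * m).
have q0 : 0 < q by rewrite sqrtr_gt0; lra.
have q2 : q ^+ 2 = 2 * m by rewrite sqr_sqrtr//; lra.
have := h (q / 2) (divr_gt0 q0 (ltr0n _ 2)) => /le_trans; apply.
have -> : m = q ^+ 2 / 2 by rewrite q2; field.
by rewrite le_eqVlt; apply/orP; left; apply/eqP; field; rewrite gt_eqF.
Qed.

(** With [c = w / 3] and [s = sqrt (2 L / (n V))], the exponent is minimised at [l = s / (1 + c s)],
    where [1 - l c = 1 / (1 + c s)]. The deviation is the exact inverse of the Bernstein rate, hence
    an equality. *)
Lemma bernstein_rate (n L V w : R) : 0 < n -> 0 < L -> 0 < V -> 0 <= w ->
  exists l, [/\ 0 < l, l * w < 3 &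
    l ^+ 2 / (2 * (1 - l * w / 3)) * V
    - l * (w * L / (3 * n) + Num.sqrt (2 * V * L / n)) = - (L / n)].
Proof.
move=> n0 L0 V0 w0.
pose s := Num.sqrt (2 * L / (n * V)); pose c := w / 3.
have c0 : 0 <= c by rewrite divr_ge0.
have s0 : 0 < s by rewrite sqrtr_gt0 divr_gt0 ?mulr_gt0.
have s2 : s ^+ 2 = 2 * L / (n * V).
  by rewrite sqr_sqrtr// divr_ge0// mulr_ge0// ltW.
have d0 : 0 < 1 + c * s by rewrite ltr_wpDr// mulr_ge0// ltW.
(* Eliminating [V] in favour of [s] turns the final identity into one between rational functions. *)
have VE : V = 2 * L / (n * s ^+ 2) by rewrite s2; field; rewrite !gt_eqF.
have sqE : Num.sqrt (2 * V * L / n) = s * V.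
  rewrite -[RHS]ger0_norm; last by rewrite mulr_ge0 ?ltW.
  by rewrite -sqrtr_sqr; congr Num.sqrt; rewrite exprMn s2; field; rewrite !gt_eqF.
have lc : 1 - s / (1 + c * s) * w / 3 = (1 + c * s)^-1.
  by rewrite /c; field; move: d0; rewrite /c => d0; apply/eqP; lra.
exists (s / (1 + c * s)); split.
- by rewrite divr_gt0.
- have : 0 < 1 - s / (1 + c * s) * w / 3 by rewrite lc invr_gt0.
  by lra.
rewrite lc sqE VE; have -> : w = 3 * c by rewrite /c; field.
by field; rewrite !gt_eqF.
Qed.

End risk_bound.

(** * Moments of the importance weights and of the weighted loss *)

Section importance_weights.
Context {R : realType} {d : measure_display} {X : measurableType d} {A : finType}
  (PX : probability X R) (p0 pt : X -> A -> R) (w : R).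

Lemma measurable_fun_ratio a : is_policy p0 -> (forall x a, 0 < p0 x a) ->
  is_policy pt -> measurable_fun setT (fun x => pt x a / p0 x a).
Proof.
move=> [_ _ mp0] p0_gt0 [_ _ mpt]; apply: measurable_funM => //.
exact: measurable_fun_invr.
Qed.

Lemma cond_KLE : cond_KL PX pt p0 = (\int[PX]_x (KL (pt x) (p0 x))%:E)%E.
Proof.
apply: eq_integral => x _; congr EFin; apply: eq_bigr => a _.
by case: eqP => // ->; rewrite mul0r.
Qed.

(** If [pt x] vanishes somewhere, that term is [+oo] and no term is [-oo]; otherwise all terms are
    real. *)
Lemma sum_rev_termE x : (forall a, 0 < p0 x a) -> (forall a, 0 <= pt x a) ->
  ((forall a, 0 < pt x a) /\
    (\sum_a rev_term pt p0 x a = (KL (p0 x) (pt x))%:E)%E) \/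
  (\sum_a rev_term pt p0 x a = +oo)%E.
Proof.
move=> p0_gt0 pt_ge0; have [[b b0]|h] := pselect (exists b, pt x b = 0).
  right; apply/eqP; rewrite esum_eqy => [|a _].
    apply/existsP; exists b; rewrite /rev_term (gt_eqF (p0_gt0 b)).
    by rewrite b0 eqxx.
  by rewrite /rev_term; do 2 case: ifP => // _.
have pt_gt0 a : 0 < pt x a.
  by rewrite lt_def pt_ge0 andbT; apply/eqP => pa; apply: h; exists a.
left; split=> //; rewrite -sumEFin; apply: eq_bigr => a _.
by rewrite /rev_term (gt_eqF (p0_gt0 a)) (gt_eqF (pt_gt0 a)).
Qed.

Hypothesis pol0 : is_policy p0.
Hypothesis p0_gt0 : forall x a, 0 < p0 x a.
Hypothesis polt : is_policy pt.
Hypothesis ratio_le : forall x a, pt x a / p0 x a <= w.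
Hypothesis w_gt0 : 0 < w.

Let pt_ge0 x a : 0 <= pt x a. Proof. by have [] := polt. Qed.
Let pt1 x : \sum_a pt x a = 1. Proof. by have [] := polt. Qed.
Let p01 x : \sum_a p0 x a = 1. Proof. by have [] := pol0. Qed.
Let mpt a : measurable_fun setT (pt ^~ a). Proof. by have [] := polt. Qed.
Let mp0 a : measurable_fun setT (p0 ^~ a). Proof. by have [] := pol0. Qed.

(** Second moment of [pt / p0] under [p0], that is, 1 plus the chi-square divergence. *)
Let chi x := \sum_a pt x a ^+ 2 / p0 x a.

Lemma chi_ge0 x : 0 <= chi x.
Proof. by apply: sumr_ge0 => a _; rewrite divr_ge0 ?sqr_ge0// ltW. Qed.

Lemma measurable_chi : measurable_fun setT chi.
Proof.
apply: measurable_sum => a; apply: measurable_funM; last exact: measurable_fun_invr.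
exact: measurable_funX.
Qed.

Lemma measurable_KL : measurable_fun setT (fun x => KL (pt x) (p0 x)).
Proof.
apply: measurable_sum => a; apply: measurable_funM => //.
apply: (measurableT_comp (@measurable_ln R)).
exact: measurable_fun_ratio.
Qed.

(** Since [ln t <= t - 1] and the ratio is at most [w], the integrand is at most [w]. The minimum of
    the two divergences is therefore finite and [fine] keeps its value. *)
Lemma cond_KL_fin_num : cond_KL PX pt p0 \is a fin_num.
Proof.
rewrite cond_KLE ge0_fin_numE; last first.
  by apply: integral_ge0 => x _; rewrite lee_fin KL_ge0.
apply: (@le_lt_trans _ _ (\int[PX]_x w%:E)%E).
  apply: ge0_le_integral => //.
  - by move=> x _; rewrite lee_fin KL_ge0.
  - by apply/measurable_EFinP; exact: measurable_KL.
  move=> x _; rewrite lee_fin -[leRHS]mul1r -(pt1 x) mulr_suml.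
  apply: ler_sum => a _; have := pt_ge0 x a.
  rewrite le_eqVlt => /orP[/eqP <-|pa]; first by rewrite !mul0r.
  rewrite ler_wpM2l//; apply: le_trans (ratio_le x a).
  have r0 : 0 < pt x a / p0 x a by rewrite divr_gt0.
  by have := expR_ge1Dx (ln (pt x a / p0 x a)); rewrite lnK ?posrE//; lra.
by rewrite integral_cst// [X in (_ * X)%E]probability_setT mule1 ltry.
Qed.

Lemma measurable_rev_KL :
  measurable_fun setT (fun x => \sum_a rev_term pt p0 x a)%E.
Proof.
apply: emeasurable_sum => a.
have -> : (fun x => rev_term pt p0 x a) = (fun x =>
    if pt x a == 0 then +oo%E else (p0 x a * ln (p0 x a / pt x a))%:E).
  by apply/funext => x; rewrite /rev_term (gt_eqF (p0_gt0 x a)).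
(* [ln (p0 / pt) = - ln (pt / p0)], the junk value at [pt = 0] included *)
have -> : (fun x => if pt x a == 0 then +oo%E
      else (p0 x a * ln (p0 x a / pt x a))%:E) = (fun x =>
    if pt x a == 0 then +oo%E else (p0 x a * - ln (pt x a / p0 x a))%:E).
  apply/funext => x; case: ifPn => // pa.
  by rewrite -lnV ?invf_div// posrE divr_gt0// lt_def pa pt_ge0.
apply: measurable_fun_ifT => //; first exact: measurable_fun_eqr.
apply/measurable_EFinP; apply: measurable_funM => //.
apply: measurableT_comp => //; apply: (measurableT_comp (@measurable_ln R)).
exact: measurable_fun_ratio.
Qed.

Lemma second_moment_le s : 0 < s ->
  (\int[PX]_x (chi x)%:E <= (1 + w / 2 * s)%:E +
    (w / (4 * s))%:E * mine (cond_KL PX pt p0) (rev_cond_KL PX pt p0))%E.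
Proof.
move=> s0; have w0 := ltW w_gt0.
have a0 : 0 <= 1 + w / 2 * s.
  by rewrite addr_ge0// mulr_ge0 ?(ltW s0)// divr_ge0.
have b0 : 0 < w / (4 * s) by rewrite divr_gt0// mulr_gt0.
rewrite minEle; case: ifP => _.
  rewrite cond_KLE; apply: integral_le_affine (ltW b0) _ => //.
  - exact: measurable_chi.
  - exact: chi_ge0.
  - by apply/measurable_EFinP; exact: measurable_KL.
  - by move=> x; rewrite lee_fin KL_ge0.
  by move=> x; rewrite -EFinM -EFinD lee_fin; exact: sum_sqr_div_le_KL.
apply: integral_le_affine (ltW b0) _ => //.
- exact: measurable_chi.
- exact: chi_ge0.
- exact: measurable_rev_KL.
- move=> x; have [[pt_gt0 ->]| ->//] := sum_rev_termE x (p0_gt0 x) (pt_ge0 x).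
  by rewrite lee_fin KL_ge0// => a; rewrite ltW.
move=> x; have [[pt_gt0 ->]| ->] := sum_rev_termE x (p0_gt0 x) (pt_ge0 x).
  by rewrite -EFinM -EFinD lee_fin; exact: sum_sqr_div_le_revKL.
(* Strict positivity of the coefficient matters: [0 * +oo] would be 0. *)
by rewrite gt0_muley ?lte_fin// addey// leey.
Qed.

(** The parameter [s] is optimised only after integration over the contexts, so one [s] serves all
    of them. *)
Lemma second_moment_le_sqrt : (\int[PX]_x (chi x)%:E <=
  (1 + w / 2 * Num.sqrt
    (2 * fine (mine (cond_KL PX pt p0) (rev_cond_KL PX pt p0))))%:E)%E.
Proof.
have KL0 : (0 <= cond_KL PX pt p0)%E.
  by rewrite cond_KLE; apply: integral_ge0 => x _; rewrite lee_fin KL_ge0.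
have rKL0 : (0 <= rev_cond_KL PX pt p0)%E.
  apply: integral_ge0 => x _.
  have [[pt_gt0 ->]| ->//] := sum_rev_termE x (p0_gt0 x) (pt_ge0 x).
  by rewrite lee_fin KL_ge0// => a; rewrite ltW.
set m := mine _ _.
have m0 : (0 <= m)%E by rewrite le_min KL0.
have mfin : m \is a fin_num.
  rewrite ge0_fin_numE// (@le_lt_trans _ _ (cond_KL PX pt p0))//.
    by rewrite ge_min lexx.
  by rewrite -ge0_fin_numE// cond_KL_fin_num.
have le_s s : 0 < s -> (\int[PX]_x (chi x)%:E <=
    (1 + w / 2 * s + w / (4 * s) * fine m)%:E)%E.
  by move=> s0; rewrite EFinD EFinM fineK//; exact: second_moment_le.
have I0 : (0 <= \int[PX]_x (chi x)%:E)%E.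
  by apply: integral_ge0 => x _; rewrite lee_fin chi_ge0.
have Ifin : (\int[PX]_x (chi x)%:E)%E \is a fin_num.
  by rewrite ge0_fin_numE// (le_lt_trans (le_s 1 ltr01))// ltry.
rewrite -(fineK Ifin) lee_fin; apply: le_sqrt_of_linear.
- exact: ltW.
- exact: fine_ge0.
- by move=> s s0; rewrite -lee_fin fineK//; exact: le_s.
Qed.

Context (fr : X -> A -> R).
Hypothesis fr_bound : forall x a, -1 <= fr x a <= 0.
Hypothesis mfr : forall a, measurable_fun setT (fun x => fr x a).

Definition weighted_loss x a := - fr x a * (pt x a / p0 x a).

Lemma weighted_loss_ge0 x a : 0 <= weighted_loss x a.
Proof.
have /andP[_ f0] := fr_bound x a.
by rewrite mulr_ge0 ?oppr_ge0// divr_ge0// ltW.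
Qed.

Lemma weighted_loss_le x a : weighted_loss x a <= pt x a / p0 x a.
Proof.
have /andP[f1 _] := fr_bound x a; rewrite -[leRHS]mul1r ler_wpM2r//; last by lra.
by rewrite divr_ge0// ltW.
Qed.

Lemma measurable_weighted_loss a : measurable_fun setT (weighted_loss ^~ a).
Proof.
apply: measurable_funM; last exact: measurable_fun_ratio.
exact: measurableT_comp.
Qed.

(** The expected loss lies between 0 and 1 at each context, so the integral is finite and the [fine]
    inside [risk] loses nothing. *)
Lemma integral_loss :
  (\int[PX]_x (- \sum_a pt x a * fr x a)%:E = (- risk PX fr pt)%:E)%E.
Proof.
have loss0 x : 0 <= - \sum_a pt x a * fr x a.
  rewrite -sumrN sumr_ge0// => a _; have /andP[_ f0] := fr_bound x a.
  by rewrite -mulrN mulr_ge0// oppr_ge0.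
have loss1 x : - (\sum_a pt x a * fr x a) <= 1.
  rewrite -sumrN -(pt1 x); apply: ler_sum => a _.
  by have /andP[f1 _] := fr_bound x a; have := pt_ge0 x a; nra.
have mloss : measurable_fun setT (fun x => - \sum_a pt x a * fr x a).
  apply: measurableT_comp => //; apply: measurable_sum => a.
  exact: measurable_funM.
have Ifin : (\int[PX]_x (- \sum_a pt x a * fr x a)%:E)%E \is a fin_num.
  rewrite ge0_fin_numE; last by apply: integral_ge0 => x _; rewrite lee_fin.
  apply: (@le_lt_trans _ _ (\int[PX]_x 1%:E)%E).
    apply: ge0_le_integral => //; first by move=> x _; rewrite lee_fin.
      exact/measurable_EFinP.
    by move=> x _; rewrite lee_fin.
  by rewrite integral_cst// [X in (_ * X)%E]probability_setT mule1 ltry.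
rewrite /risk /Rintegral.
under [in RHS]eq_integral => x _.
  rewrite -[\sum_a _]opprK EFinN; over.
rewrite integral_ge0N; last by move=> x _; rewrite lee_fin.
by rewrite fineN opprK fineK.
Qed.

(** Integrate [expR (l Y) <= 1 + l Y + k Y^2] for the weighted loss [Y], whose mean is minus the
    risk and whose second moment is at most that of the ratio; then apply [1 + z <= expR z]. *)
Lemma mgf_weighted_loss_le (l V : R) : 0 < l -> l * w < 3 ->
  (\int[PX]_x (chi x)%:E <= V%:E)%E ->
  (\int[PX]_x (\sum_a p0 x a * expR (l * weighted_loss x a))%:E <=
   (expR (- (l * risk PX fr pt) + l ^+ 2 / (2 * (1 - l * w / 3)) * V))%:E)%E.
Proof.
move=> l0 lw chiV; set k := l ^+ 2 / _.
have k0 : 0 <= k by rewrite divr_ge0 ?sqr_ge0//; lra.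
have loss0 x : 0 <= - \sum_a pt x a * fr x a.
  rewrite -sumrN sumr_ge0// => a _; have /andP[_ f0] := fr_bound x a.
  by rewrite -mulrN mulr_ge0// oppr_ge0.
have mloss : measurable_fun setT (fun x => - \sum_a pt x a * fr x a).
  apply: measurableT_comp => //; apply: measurable_sum => a.
  exact: measurable_funM.
have mchi := measurable_chi.
apply: (@le_trans _ _ (\int[PX]_x
    (1 + l * (- \sum_a pt x a * fr x a) + k * chi x)%:E)%E); last first.
  rewrite integral_affine//; [|exact: chi_ge0|exact: ltW].
  rewrite integral_loss.
  apply: (@le_trans _ _ ((1 - l * risk PX fr pt) + k * V)%:E).
    by rewrite -EFinM mulrN -EFinD [leRHS]EFinD leeD// [leRHS]EFinM lee_wpmul2l.
  by rewrite lee_fin -addrA expR_ge1Dx.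
apply: ge0_le_integral => //.
- by move=> x _; rewrite lee_fin sumr_ge0// => a _; rewrite mulr_ge0 ?expR_ge0// ltW.
- apply/measurable_EFinP; apply: measurable_sum => a; apply: measurable_funM => //.
  apply: (measurableT_comp (@measurable_expR R)); apply: measurable_funM => //.
  exact: measurable_weighted_loss.
- apply/measurable_EFinP; apply: measurable_funD; last exact: measurable_funM.
  by apply: measurable_funD => //; exact: measurable_funM.
(* Writing 1 as the sum of [p0 x] makes the comparison termwise in the action. *)
move=> x _; rewrite lee_fin -(p01 x) -sumrN !mulr_sumr -!big_split/=.
apply: ler_sum => a _.
have y0 := weighted_loss_ge0 x a; have yr := weighted_loss_le x a.
have yw : l * weighted_loss x a <= l * w.
  by rewrite ler_wpM2l ?(ltW l0)// (le_trans yr).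
have ly0 : 0 <= l * weighted_loss x a by rewrite mulr_ge0// ltW.
have : expR (l * weighted_loss x a) <= 1 + l * weighted_loss x a +
    k * weighted_loss x a ^+ 2.
  rewrite (le_trans (@expR_le_bernstein _ (l * w) _ _ lw))// ?ly0//.
  by rewrite lerD2l le_eqVlt exprMn /k mulrAC eqxx.
move=> /(ler_wpM2l (ltW (p0_gt0 x a))) /le_trans; apply.
rewrite !mulrDr mulr1.
have -> : p0 x a * (l * weighted_loss x a) = l * (- (pt x a * fr x a)).
  by rewrite /weighted_loss; field; rewrite gt_eqF.
rewrite lerD2l mulrCA ler_wpM2l//.
have -> : pt x a ^+ 2 / p0 x a = p0 x a * (pt x a / p0 x a) ^+ 2.
  by field; rewrite gt_eqF.
by rewrite ler_wpM2l ?(ltW (p0_gt0 _ _))// ler_pXn2r// ?nnegrE// (le_trans y0).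
Qed.

End importance_weights.

(** * Chernoff bound for the sum of the weighted losses *)

Theorem theorem1 (R : realType) (d : measure_display) (X : measurableType d)
  (A : finType) (dO : measure_display) (Omega : measurableType dO)
  (PX : probability X R) (p0 pt : X -> A -> R) (fr : X -> A -> R)
  (P : probability Omega R) (n : nat) (xs : 'I_n -> Omega -> X)
  (acts : 'I_n -> Omega -> A) (wm delta : R) :
  is_policy p0 -> (forall x a, 0 < p0 x a) ->
  is_policy pt ->
  has_ubound (ratio_set pt p0) -> wm = sup (ratio_set pt p0) ->
  (forall x a, -1 <= fr x a <= 0) -> (forall a, measurable_fun setT (fun x => fr x a)) ->
  (0 < n)%N ->
  iid_sample P PX p0 xs acts ->
  0 < delta < 1 ->
  (P [set w | (risk PX fr pt <=
        emp_risk fr pt p0 (fun i => xs i w) (fun i => acts i w)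
        + wm * ln delta^-1 / (3 * n%:R)
        + Num.sqrt ((wm * Num.sqrt (2 * fine (mine (cond_KL PX pt p0) (rev_cond_KL PX pt p0))) + 2)
                    * ln delta^-1 / n%:R))%R]
   >= (1 - delta)%:E)%E.
Proof.
move=> pol0 p0_gt0 polt ubd wmE fr_bound mfr n0 iid /andP[delta0 delta1].
have [mx ma _ _] := iid.
have ratio_le x a : pt x a / p0 x a <= wm.
  by rewrite wmE; apply: ub_le_sup => //; exists x, a.
have wm1 : 1 <= wm.
  (* A probability measure forces [X] to be inhabited; at any [x], summing [pt x a <= wm * p0 x a]
     over [a] gives [1 <= wm]. *)
  have [x _] : [set: X] !=set0.
    apply/set0P/eqP => X0; have := @probability_setT _ _ _ PX.
    by rewrite X0 measure0 => /eqP; rewrite eqe eq_sym oner_eq0.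
  have [[_ p01 _] [_ pt1 _]] := (pol0, polt).
  rewrite -(pt1 x) -[leRHS]mulr1 -(p01 x) mulr_sumr; apply: ler_sum => a _.
  by rewrite -ler_pdivrMr.
have wm0 : 0 < wm by exact: lt_le_trans wm1.
have nR : 0 < n%:R :> R by rewrite ltr0n.
set L := ln delta^-1.
have L0 : 0 < L by rewrite ln_gt0// invf_gt1.
set D := Num.sqrt (2 * fine _).
pose V := 1 + wm / 2 * D.
have V0 : 0 < V.
  by rewrite ltr_pwDl// mulr_ge0 ?sqrtr_ge0// divr_ge0// ltW.
(* The radicand becomes [2 V L / n], the form in [bernstein_rate], with [V] the bound of
   [second_moment_le_sqrt]. *)
have -> : wm * D + 2 = 2 * V by rewrite /V; field.
have [l [l0 lw rate]] := bernstein_rate _ _ _ _ nR L0 V0 (ltW wm0).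
set eps := wm * L / _ + _ in rate.
set mgf := - (l * risk PX fr pt) + l ^+ 2 / (2 * (1 - l * wm / 3)) * V.
pose g x a := expR (l * weighted_loss p0 pt fr x a).
have mwl := measurable_weighted_loss p0 pt pol0 p0_gt0 polt fr mfr.
have mg a : measurable_fun setT (g ^~ a).
  by apply: (measurableT_comp (@measurable_expR R)); exact: measurable_funM.
have mgf_le i : (\int[P]_w (g (xs i w) (acts i w))%:E <= (expR mgf)%:E)%E.
  rewrite (integral_sample_law P PX p0)//; last by move=> x a; exact: expR_ge0.
  by apply: mgf_weighted_loss_le => //; exact: second_moment_le_sqrt.
pose S w := \sum_i weighted_loss p0 pt fr (xs i w) (acts i w).
have mS : measurable_fun setT S.
  by apply: measurable_sum => i; exact: measurable_fun_xact.
(* As the empirical risk is [- S / n], this is exactly the failure of the claimed inequality. *)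
pose bad := [set w | n%:R * (eps - risk PX fr pt) < S w].
have mbad : measurable bad.
  have -> : bad = S @^-1` `]n%:R * (eps - risk PX fr pt), +oo[%classic.
    by apply/seteqP; split => w /=; rewrite in_itv/= andbT.
  by rewrite -[X in measurable X]setTI; exact: mS.
rewrite (_ : [set w | _] = ~` bad); last first.
  have empE w : emp_risk fr pt p0 (xs^~ w) (acts^~ w) = - (S w / n%:R).
    rewrite /emp_risk mulrC -mulNr -sumrN; congr (_ / _); apply: eq_bigr => i _.
    by rewrite /weighted_loss mulNr opprK.
  apply/seteqP; split => w /=; rewrite empE -addrA -/eps.
    move=> h; apply/negP; rewrite -leNgt -ler_pdivrMl// mulrC; lra.
  by move=> /negP; rewrite -leNgt -ler_pdivrMl// mulrC; lra.
rewrite probability_setC// EFinB leeB//.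
have Pfin : P bad \is a fin_num by rewrite fin_num_measure.
have : (P bad * (expR (l * (n%:R * (eps - risk PX fr pt))))%:E <=
    (expR (n%:R * mgf))%:E)%E.
  apply: (le_trans (chernoff_gt P S l _ mS (ltW l0))).
  have -> : (\int[P]_w (expR (l * S w))%:E =
      \int[P]_w (\prod_i g (xs i w) (acts i w))%:E)%E.
    by apply: eq_integral => w _; rewrite /S mulr_sumr expR_sum.
  rewrite (integral_sample_prod P PX p0 n xs acts (fun=> g))//; last 2 first.
  - by move=> _ x a; exact: expR_ge0.
  - by move=> i; exact: le_lt_trans (mgf_le i) (ltry _).
  have I0 i : (0 <= \int[P]_w (g (xs i w) (acts i w))%:E)%E.
    by apply: integral_ge0 => w _; rewrite lee_fin expR_ge0.
  have Ifin i : (\int[P]_w (g (xs i w) (acts i w))%:E)%E \is a fin_num.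
    by rewrite ge0_fin_numE//; exact: le_lt_trans (mgf_le i) (ltry _).
  under eq_bigr => i _ do rewrite -(fineK (Ifin i)).
  rewrite prodEFin lee_fin expRM_natl -[X in expR mgf ^+ X]card_ord -prodr_const.
  apply: ler_prod => i _; rewrite fine_ge0//= -lee_fin fineK//.
rewrite -(fineK Pfin) -EFinM lee_fin -ler_pdivlMr ?expR_gt0// -expRB => /le_trans.
rewrite lee_fin; apply.
(* The risk cancels between the two exponents, leaving [n] times the quantity [- (L / n)] of
   [rate]. *)
have -> : n%:R * mgf - l * (n%:R * (eps - risk PX fr pt)) = - L.
  have -> : - L = n%:R * (- (L / n%:R)) by field; rewrite gt_eqF.
  by rewrite -rate /mgf; ring.
by rewrite expRN /L lnK ?posrE ?invr_gt0// invrK.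
Qed.
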